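(* Let $n\ge 3$ and let $W$ be the Coxeter group of type $\widetilde{A}_{n-1}$. The map $\varphi':W^{FC}\to \mathcal{O}^*_n\setminus\mathcal{E}_n$ is a (well-defined) bijection such that $\ell(w)=\operatorname{ht}'(\varphi'(w))$ for all $w\in W^{FC}$.
   Context: $W$ has generators $s_0,\dots,s_{n-1}$ and Coxeter graph the $n$-cycle: with $s_n:=s_0$, $m_{s_is_{i+1}}=3$ for $0\le i\le n-1$, and all other pairs of distinct generators commute. $\ell$ is the Coxeter length. An element $w\in W$ is fully commutative (FC) if any reduced expression of $w$ can be obtained from any other one using only commutation relations; $W^{FC}$ is the set of FC elements. Heaps. For a finite graph $\Gamma$ on vertex set $S$ and a word $\mathbf w=s_{a_1}\cdots s_{a_l}$ in $S$, $\operatorname{Heap}(\mathbf w)$ is the poset on $\{1,\dots,l\}$ whose order is the transitive closure of the relations $i\prec j$ for $i<j$ with $s_{a_i},s_{a_j}$ equal or adjacent in $\Gamma$, each $i$ being labeled $s_{a_i}$. Up to label-preserving isomorphism it depends only on the commutation class of $\mathbf w$; for $w$ FC, $\operatorname{Heap}(w):=\operatorname{Heap}(\mathbf w)$ for any reduced word $\mathbf w$ of $w$. For $H=\operatorname{Heap}(w)$, $|H_{s}|$ is the number of elements labeled $s$, and $H_{\{s,s'\}}$ is the chain of elements labeled $s$ or $s'$ (for $s,s'$ adjacent). Walks. A walk of length $n$ is a sequence $P=(P_0,\dots,P_n)$ of points of $\mathbb{N}^2$ with $P_0$ of abscissa $0$ and steps in $\{(1,1),(1,-1),(1,0)\}$,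 each horizontal step $(1,0)$ being labeled $L$ or $R$. $\mathcal{O}^*_n$ is the set of walks of length $n$ whose starting and ending points are at the same height and such that all horizontal steps at height $0$ are labeled $L$. $\mathcal{E}_n\subseteq\mathcal{O}^*_n$ is the set of walks with all vertices at the same positive height and all $n$ steps with the same label (either all $L$ or all $R$). If $P_i=(i,h_i)$, then $\operatorname{ht}'(P)=\sum_{i=0}^{n-1}h_i$. Map $\varphi'$. For $w\in W^{FC}$ and $H=\operatorname{Heap}(w)$, $\varphi'(w)$ is the walk $(P_0,\dots,P_n)$ with $P_i=(i,|H_{s_i}|)$ (where $s_n=s_0$). If $|H_{s_i}|=|H_{s_{i+1}}|>0$, the step $P_i\to P_{i+1}$ is labeled $L$ (resp. $R$) if the lowest element of $H_{\{s_i,s_{i+1}\}}$ has label $s_{i+1}$ (resp. $s_i$); if $|H_{s_i}|=|H_{s_{i+1}}|=0$ it is labeled $L$. *)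

(* Defs.v *)
From HB Require Import structures.
From Stdlib Require Import Relation_Operators.
From mathcomp Require Import all_boot all_order all_algebra.
From mathcomp Require Import boolp classical_sets functions.

Set Implicit Arguments.
Unset Strict Implicit.
Unset Printing Implicit Defensive.

(* The value [0] encodes an infinite label. *)
Record coxeter_matrix (S : finType) := CoxeterMatrix {
  coxm :> S -> S -> nat;
  coxm_diag : forall s, coxm s s = 1;
  coxm_sym : forall s t, coxm s t = coxm t s;
  coxm_neq1 : forall s t, s != t -> coxm s t != 1 }.

Definition coxeter_graph (S : finType) (m : coxeter_matrix S) : rel S :=
  [rel s t | (s != t) && (m s t != 2)].

(* The congruence on the free monoid of words generated by (st)^m(s,t) = 1.
   Since m(s,s) = 1 makes every generator an involution, the quotient monoid is
   the group presented by these relations. *)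
Inductive cox_eq (S : finType) (m : coxeter_matrix S) : seq S -> seq S -> Prop :=
| cox_rel s t : cox_eq m (flatten (nseq (m s t) [:: s; t])) [::]
| cox_refl u : cox_eq m u u
| cox_sym u v : cox_eq m u v -> cox_eq m v u
| cox_trans u v w : cox_eq m u v -> cox_eq m v w -> cox_eq m u w
| cox_cat u u' v v' :
    cox_eq m u u' -> cox_eq m v v' -> cox_eq m (u ++ v) (u' ++ v').

Section CoxeterGroup.
Variables (S : finType) (m : coxeter_matrix S).

Definition cox_eqb : rel (seq S) := fun u v => `[< cox_eq m u v >].

Fact cox_eqb_refl : reflexive cox_eqb.
Proof. by move=> u; apply/asboolP; apply: cox_refl. Qed.

Fact cox_eqb_sym : symmetric cox_eqb.
Proof. by move=> u v; apply/asboolP/asboolP; apply: cox_sym. Qed.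

Fact cox_eqb_trans : transitive cox_eqb.
Proof.
by move=> v u w /asboolP uv /asboolP vw; apply/asboolP; apply: cox_trans vw.
Qed.

Canonical cox_equiv := EquivRel cox_eqb cox_eqb_refl cox_eqb_sym cox_eqb_trans.

Local Open Scope quotient_scope.

Definition coxeter_group : Type := {eq_quot cox_equiv}.
HB.instance Definition _ := Choice.on coxeter_group.

Definition word_class (u : seq S) : coxeter_group := \pi_{eq_quot cox_equiv} u.
Definition class_word (x : coxeter_group) : seq S :=
  repr (x : {eq_quot cox_equiv}).

Fact class_wordK : cancel class_word word_class.
Proof. by move=> x; apply: (@reprK _ {eq_quot cox_equiv}). Qed.

Fact word_classP u v : word_class u = word_class v <-> cox_eq m u v.
Proof.
split=> [/eqmodP/asboolP // | uv].
by apply/eqmodP/asboolP.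
Qed.

Definition cox_one := word_class [::].
Definition cox_mul (x y : coxeter_group) :=
  word_class (class_word x ++ class_word y).
Definition cox_inv (x : coxeter_group) := word_class (rev (class_word x)).

Fact cox_mulE u v : cox_mul (word_class u) (word_class v) = word_class (u ++ v).
Proof.
by apply/word_classP; apply: cox_cat; apply/word_classP; rewrite class_wordK.
Qed.

Fact cox_eq_catrev u : cox_eq m (rev u ++ u) [::].
Proof.
elim: u => [|s u IHu]; first exact: cox_refl.
rewrite rev_cons cat_rcons; apply: cox_trans IHu.
apply: cox_cat; first exact: cox_refl.
rewrite -[s :: s :: u]/([:: s; s] ++ u) -[X in cox_eq m _ X]cat0s.
apply: cox_cat; last exact: cox_refl.
by have := cox_rel m s s; rewrite coxm_diag.
Qed.

Fact cox_mulA : associative cox_mul.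
Proof.
move=> x y z; rewrite -[x]class_wordK -[y]class_wordK -[z]class_wordK.
by rewrite !cox_mulE catA.
Qed.

Fact cox_mul1 : left_id cox_one cox_mul.
Proof. by move=> x; rewrite -[x]class_wordK cox_mulE. Qed.

Fact cox_1mul : right_id cox_one cox_mul.
Proof. by move=> x; rewrite -[x]class_wordK cox_mulE cats0. Qed.

Fact cox_mulV : left_inverse cox_one cox_inv cox_mul.
Proof.
move=> x; rewrite -[in X in cox_mul _ X](class_wordK x) cox_mulE.
by apply/word_classP; apply: cox_eq_catrev.
Qed.

Fact cox_Vmul : right_inverse cox_one cox_inv cox_mul.
Proof.
move=> x; rewrite -[in X in cox_mul X _](class_wordK x) cox_mulE.
apply/word_classP; rewrite -[in X in X ++ _](revK (class_word x)).
exact: cox_eq_catrev.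
Qed.

HB.instance Definition _ := isGroup.Build coxeter_group
  cox_mulA cox_mul1 cox_1mul cox_mulV cox_Vmul.

Definition cox_gen (s : S) : coxeter_group := word_class [:: s].

Fact coxeter_group_universal (G : groupType) (f : S -> G) :
  (forall s t, (f s * f t) ^+ m s t = 1)%g ->
  exists F : coxeter_group -> G,
    (forall x y, F (x * y) = F x * F y)%g /\ forall s, F (cox_gen s) = f s.
Proof.
move=> H; pose ev u : G := (\big[*%g/1]_(s <- u) f s)%g.
have evD u v : ev (u ++ v) = (ev u * ev v)%g by rewrite /ev big_cat.
have E u v : cox_eq m u v -> ev u = ev v.
  elim=> {u v} [s t | // | // | u v w _ -> _ -> // | u u' v v' _ Eu _ Ev].
    rewrite {2}/ev big_nil -(H s t); elim: (m s t) => [|k IHk].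
      by rewrite /ev /= big_nil expg0.
    rewrite -[flatten _]/([:: s; t] ++ flatten (nseq k [:: s; t])) evD IHk.
    by rewrite expgS /ev !big_cons big_nil mulg1.
  by rewrite !evD Eu Ev.
have K u : ev (class_word (word_class u)) = ev u.
  by apply: E; apply/word_classP; rewrite class_wordK.
exists (fun x => ev (class_word x)); split=> [x y|s].
  by rewrite [LHS]K evD.
by rewrite K /ev big_seq1.
Qed.

Definition expression_of (w : coxeter_group) (u : seq S) : Prop :=
  (\big[*%g/1]_(s <- u) cox_gen s)%g = w.

Fact word_prodE u : (\big[*%g/1]_(s <- u) cox_gen s)%g = word_class u.
Proof.
elim: u => [|s u IHu]; first by rewrite big_nil.
by rewrite big_cons IHu; apply: cox_mulE.
Qed.

Fact expression_length_exists w :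
  exists k, `[< exists2 u, expression_of w u & size u = k >].
Proof.
exists (size (class_word w)); apply/asboolP; exists (class_word w) => //.
by rewrite /expression_of word_prodE class_wordK.
Qed.

Definition cox_length (w : coxeter_group) : nat :=
  ex_minn (expression_length_exists w).

Definition reduced_expression_of (w : coxeter_group) (u : seq S) : Prop :=
  expression_of w u /\ size u = cox_length w.

Fact reduced_expression_exists w : exists u, reduced_expression_of w u.
Proof.
rewrite /reduced_expression_of /cox_length.
by case: ex_minnP => k /asboolP[u uw uk] _; exists u.
Qed.

Definition reduced_word (w : coxeter_group) : seq S :=
  sval (cid (reduced_expression_exists w)).

Inductive comm_move : seq S -> seq S -> Prop :=
| CommMove u v s t :
    m s t = 2 -> comm_move (u ++ [:: s; t] ++ v) (u ++ [:: t; s] ++ v).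

Definition comm_equiv : seq S -> seq S -> Prop :=
  clos_refl_trans (seq S) comm_move.

Definition fully_commutative : set coxeter_group :=
  [set w | forall u v, reduced_expression_of w u ->
                       reduced_expression_of w v -> comm_equiv u v].

End CoxeterGroup.

Arguments cox_gen {S} m s.
Arguments fully_commutative {S} m.

Record labelled_poset (S : finType) := LabelledPoset {
  lp_carrier :> finType;
  lp_le : rel lp_carrier;
  lp_label : lp_carrier -> S }.

Arguments lp_le {S} H : rename.
Arguments lp_label {S} H : rename.

Definition heap_cover (S : finType) (Gamma : rel S) (u : seq S) :
    rel 'I_(size u) :=
  [rel i j : 'I_(size u) | let s := tnth (in_tuple u) i in
                           let t := tnth (in_tuple u) j in
                           (i < j) && ((s == t) || Gamma s t)].

Definition Heap (S : finType) (Gamma : rel S) (u : seq S) : labelled_poset S :=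
  {| lp_carrier := 'I_(size u);
     lp_le := connect (heap_cover Gamma (u := u));
     lp_label := tnth (in_tuple u) |}.

Definition label_count (S : finType) (H : labelled_poset S) (s : S) : nat :=
  #|[pred x : H | lp_label H x == s]|.

Definition is_lowest (S : finType) (H : labelled_poset S) (s t : S) (x : H) :
    bool :=
  (lp_label H x \in [:: s; t]) &&
  [forall (y : H | lp_label H y \in [:: s; t]), lp_le H x y].
Arguments is_lowest {S} H s t x.

(* Guarantees that the test in [phi_label] below never fails for want of a
   lowest element. *)
Fact Heap_lowest (S : finType) (Gamma : rel S) (Gsym : symmetric Gamma)
    (u : seq S) (s t : S) :
  Gamma s t -> has [in [:: s; t]] u ->
  exists x, is_lowest (Heap Gamma u) s t x.
Proof.
move=> Gst /(has_nthP s) [i0 i0u Hi0].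
have P0 : tnth (in_tuple u) (Ordinal i0u) \in [:: s; t].
  by rewrite (tnth_nth s).
case: (@arg_minnP _ (Ordinal i0u)
  (fun i => tnth (in_tuple u) i \in [:: s; t]) (@nat_of_ord _) P0) => x Px minx.
exists x; apply/andP; split => //; apply/forall_inP => y Py.
have := minx y Py; rewrite leq_eqVlt => /orP[/eqP/val_inj-> | ltxy].
  exact: connect0.
apply: connect1; rewrite /heap_cover /= ltxy /=; move: Px Py.
have Gts : Gamma t s by rewrite Gsym.
by rewrite /= !inE => /orP[]/eqP-> /orP[]/eqP->; rewrite ?eqxx ?Gst ?Gts ?orbT.
Qed.

Inductive step_label := L | R.

(* Points and labels, a priori unconstrained; label [None] means that the step
   carries no label. *)
Record prewalk (n : nat) := Prewalk {
  walk_points : {ffun 'I_n.+1 -> nat * nat};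
  walk_labels : {ffun 'I_n -> option step_label} }.

Definition wpt n (P : prewalk n) (i : nat) : nat * nat :=
  walk_points P (inord i).

Definition is_step (p q : nat * nat) (l : option step_label) : Prop :=
  q.1 = p.1.+1 /\
  [\/ q.2 = p.2.+1 /\ l = None,
      p.2 = q.2.+1 /\ l = None
    | q.2 = p.2 /\ l <> None].

Definition is_walk n (P : prewalk n) : Prop :=
  (wpt P 0).1 = 0 /\
  forall i : 'I_n, is_step (wpt P i) (wpt P i.+1) (walk_labels P i).

(* Both endpoints of a horizontal step have the same height, so it suffices to
   test the starting one. *)
Definition Ostar (n : nat) : set (prewalk n) :=
  [set P | [/\ is_walk P,
               (wpt P 0).2 = (wpt P n).2
             & forall (i : 'I_n) (l : step_label),
                 walk_labels P i = Some l -> (wpt P i).2 = 0 -> l = L]].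

Definition Econst (n : nat) : set (prewalk n) :=
  [set P | Ostar P /\
           exists h l, [/\ 0 < h,
                           forall i, i <= n -> (wpt P i).2 = h
                         & forall i : 'I_n, walk_labels P i = Some l]].

Arguments Ostar n : clear implicits.
Arguments Econst n : clear implicits.

Definition ht' n (P : prewalk n) : nat := \sum_(i < n) (wpt P i).2.

(* ['Z_n] is Z/nZ for n >= 2; the generator s_i is indexed by the class of i,
   so that s_n = s_0. *)
Section AffineA.
Variable n : nat.
Local Open Scope ring_scope.

Definition cyc_adj : rel 'Z_n := [rel i j | (j == i + 1) || (i == j + 1)].

Definition affA_m (i j : 'Z_n) : nat :=
  if i == j then 1%N else if cyc_adj i j then 3%N else 2%N.

Fact affA_m_diag i : affA_m i i = 1%N.
Proof. by rewrite /affA_m eqxx. Qed.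

Fact affA_m_sym i j : affA_m i j = affA_m j i.
Proof. by rewrite /affA_m eq_sym /cyc_adj /= orbC. Qed.

Fact affA_m_neq1 i j : i != j -> affA_m i j != 1%N.
Proof. by rewrite /affA_m => /negbTE->; case: ifP. Qed.

Definition affA : coxeter_matrix 'Z_n :=
  CoxeterMatrix affA_m_diag affA_m_sym affA_m_neq1.

Definition phi_label (H : labelled_poset 'Z_n) (i : nat) : option step_label :=
  let s : 'Z_n := i%:R in
  let t : 'Z_n := i.+1%:R in
  if label_count H s != label_count H t then None
  else if label_count H s == 0%N then Some L
  else if [exists x : H, is_lowest H s t x && (lp_label H x == t)] then Some L
  else Some R.

Definition walk_of_heap (H : labelled_poset 'Z_n) : prewalk n :=
  {| walk_points := [ffun i : 'I_n.+1 => (val i, label_count H (val i)%:R)];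
     walk_labels := [ffun i : 'I_n => phi_label H i] |}.

Definition phi' (w : coxeter_group affA) : prewalk n :=
  walk_of_heap (Heap (coxeter_graph affA) (reduced_word w)).

End AffineA.

(* Main.v *)
Require Import Defs.
From Stdlib Require Import Relation_Operators.
From mathcomp Require Import all_boot all_order all_fingroup all_algebra.
From mathcomp Require Import boolp classical_sets functions.

Set Implicit Arguments.
Unset Strict Implicit.
Unset Printing Implicit Defensive.

(** The proof goes through words. For a word [u] in Z/nZ and a letter [s], read
    [u] on the two letters [s] and [s + 1] only: this is the chain
    H_{s,s+1} of the heap of [u]. Call [u] alternating when, for every [s], no
    letter is repeated in two consecutive places of this chain. Three facts
    about this notion give the theorem.

    Alternating words are exactly the reduced words of fully commutative
    elements. By Stembridge's criterion, a word of a simply laced Coxeter group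
    is a reduced word of a fully commutative element as soon as no word of its
    commutation class has a factor [ss], or [sts] with [m s t = 3]
    ([braid_free]). The converse is a count of letters
    ([fully_commutative_braid_free]). The direct implication
    ([braid_free_unique]) is an induction on the length which rests on the
    exchange property; the latter comes from the parity of the number of times
    that a reflection occurs among the inversions of a word, which depends only
    on the group element ([odd_inversions]). On the n-cycle, a repetition
    [s ... s] in a chain encloses no occurrence of one of the two neighbours of
    [s]; then it encloses at most one occurrence of the other neighbour, which
    yields a forbidden factor, or it contains a shorter repetition of the same
    kind ([not_braid_free_gap]).

    The walk determines the alternating word up to commutations. The chain on
    [s] and [s + 1] alternates, so it is known from the numbers of its two
    letters and from its first letter; the heights give the former, and the
    latter is given by the heights if they differ and by the label of the step
    otherwise. The chains in turn determine the commutation class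
    ([comm_equiv_projections]). The length is the sum of the heights because a
    reduced word has as many letters.

    Finally, the walks obtained are those of O* minus E. Encode a walk by its
    heights [h] and by the orientations [o], where [o s] says that the chain on
    [s] and [s + 1] starts with [s + 1]. A letter [t] can be the first one of a
    word with these data when [h t > 0] and both chains through [t] start with
    [t]; removing it leaves admissible data with smaller sum of heights. Such a
    [t] exists as long as some height is positive and [o] is not constant
    ([exists_source]). Constant [o] forces constant heights, that is a walk of
    E or the zero walk; and in the walk of a nonempty word [x u] the steps on
    both sides of [x] cannot be horizontal with the same label
    ([walk_of_heap_notin_Econst]). *)

(** * Sequences *)

Lemma has_split_first (T : Type) (p : pred T) (l : seq T) : has p l ->
  exists a x b, [/\ l = a ++ x :: b, p x & ~~ has p a].
Proof.
by case/split_find => x a b px pa; exists a, x, b; rewrite -cat_rcons.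
Qed.

Lemma not_sorted_neq (T : eqType) (p : pred T) (u : seq T) :
  ~~ sorted (fun x y => x != y) [seq x <- u | p x] ->
  exists a x b c, [/\ u = a ++ x :: b ++ x :: c, p x & ~~ has p b].
Proof.
elim: u => [//|y u IHu] /=; case: ifP => [py|_ /IHu]; last first.
  by move=> [a [x [b [c [-> px pb]]]]]; exists (y :: a), x, b, c.
case: (boolP (has p u)) => [/has_split_first[b [z [c [Du pz pb]]]]|]; last first.
  by rewrite has_filter negbK => /eqP->.
case: (eqVneq y z) Du pz => [<-|yz] Du pz.
  by exists [::], y, b, c; rewrite Du.
have E : [seq x <- u | p x] = z :: [seq x <- c | p x].
  rewrite Du filter_cat /= pz.
  by move: pb; rewrite has_filter negbK => /eqP->.
rewrite E /= yz -/(sorted _ (z :: _)) -E => /IHu[a [x [b' [c' [-> px pb']]]]].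
by exists (y :: a), x, b', c'.
Qed.

Section AlternatingSequences.
Variable T : eqType.
Implicit Types (a b x : T) (f u : seq T).

Fixpoint altseq k a b := if k is k'.+1 then a :: altseq k' b a else [::].

Lemma sorted_altseq k a b : a != b -> sorted (fun x y => x != y) (altseq k a b).
Proof.
case: k => // k; elim: k a b => //= k IHk a b ab.
by rewrite ab; apply: IHk; rewrite eq_sym.
Qed.

Lemma altseq_sorted f a b : sorted (fun x y => x != y) f ->
  {subset f <= [:: a; b]} -> head a f = a -> f = altseq (size f) a b.
Proof.
elim: f a b => //= x f IHf a b sf fab xa; rewrite {x}xa in sf fab *.
congr (_ :: _); apply: IHf; first exact: path_sorted sf.
  move=> y yf; have: y \in [:: a; b] by apply: fab; rewrite inE yf orbT.
  by rewrite !inE orbC.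
case: f sf fab => //= y f /andP[ay _] /(_ y); rewrite !inE eqxx orbT => /(_ isT).
by rewrite eq_sym (negbTE ay) => /eqP.
Qed.

Lemma count_altseq k a b : a != b ->
  count_mem a (altseq k a b) = uphalf k /\ count_mem b (altseq k a b) = k./2.
Proof.
elim: k a b => //= k IHk a b ab.
have [|-> ->] := IHk b a; first by rewrite eq_sym.
by rewrite eqxx (negbTE ab) uphalf_half.
Qed.

End AlternatingSequences.

(** * Inversions and the exchange property *)

Section Exchange.
Variables (S : finType) (m : coxeter_matrix S).
Local Open Scope group_scope.
Local Notation cl := (word_class m).
Local Notation gen := (cox_gen m).
Implicit Types (u v : seq S) (r w : coxeter_group m).

Lemma word_class_cat u v : cl (u ++ v) = cl u * cl v.
Proof. exact/esym/cox_mulE. Qed.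

Lemma word_class_cons s u : cl (s :: u) = gen s * cl u.
Proof. exact: (word_class_cat [:: s]). Qed.

Lemma word_class_nil : cl [::] = 1.
Proof. by []. Qed.

Lemma cox_gen_rel s t : (gen s * gen t) ^+ m s t = 1.
Proof.
rewrite -word_class_nil -[RHS](proj2 (word_classP _ _ _) (cox_rel m s t)).
elim: (m s t) => [|k IHk] //=.
by rewrite expgS IHk !word_class_cons mulgA.
Qed.

Lemma cox_gen_sqr s : gen s * gen s = 1.
Proof. by have := cox_gen_rel s s; rewrite coxm_diag expg1. Qed.

Lemma cox_genV s : (gen s)^-1 = gen s.
Proof. by apply: (mulgI (gen s)); rewrite mulgV cox_gen_sqr. Qed.

Lemma cox_gen_mulK s w : gen s * (gen s * w) = w.
Proof. by rewrite mulgA cox_gen_sqr mul1g. Qed.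

(** The reflections s_1 ... s_(i-1) s_i s_(i-1) ... s_1, for the successive
    prefixes s_1 ... s_i of [u]; multiplying [u] on the left by one of them
    deletes the letter s_i. *)
Fixpoint inversions u : seq (coxeter_group m) :=
  if u is s :: u' then gen s :: [seq r ^ (gen s)^-1 | r <- inversions u']
  else [::].

Lemma inversions_cat u v :
  inversions (u ++ v) = inversions u ++ [seq r ^ (cl u)^-1 | r <- inversions v].
Proof.
elim: u => [|s u IHu] /=.
  rewrite word_class_nil invg1 (eq_map (g := id)) ?map_id // => r.
  exact: conjg1.
rewrite IHu map_cat -map_comp; congr (_ :: _ ++ _); apply: eq_map => r /=.
by rewrite -conjgM -invgM -word_class_cons.
Qed.

Lemma count_inversions_conj w r (l : seq (coxeter_group m)) :
  count_mem r [seq x ^ w^-1 | x <- l] = count_mem (r ^ w) l.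
Proof.
rewrite count_map; apply: eq_count => x /=.
by apply/eqP/eqP => [<-|->]; rewrite -conjgM ?mulgV ?mulVg conjg1.
Qed.

Lemma inversions_dihedral s t k :
  inversions (flatten (nseq k [:: s; t])) =
  [seq (gen s * gen t) ^+ j * gen s | j <- iota 0 (k + k)].
Proof.
elim: k => [//|k IHk]; rewrite addSn addnS /= IHk expg0 mul1g expg1.
congr [:: _, _ & _]; first by rewrite conjgE !cox_genV mulgA.
rewrite (iotaDl 2 0) -!map_comp; apply: eq_map => j /=.
by rewrite expgS expgSr !conjgE !cox_genV !mulgA.
Qed.

(** The parity of the number of occurrences of a reflection is an invariant of
    the group element: the inversions of the relator (st)^m(s,t) are the
    elements (st)^j s with [j < 2 m s t], and this sequence runs twice through
    the same list because (st)^m(s,t) = 1. *)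
Lemma odd_inversions u v r : cox_eq m u v ->
  odd (count_mem r (inversions u)) = odd (count_mem r (inversions v)).
Proof.
move=> uv; elim: uv r => {u v}
  [s t r|u r|u v _ IH r|u v w _ IH1 _ IH2 r|u u1 v v1 uu1 IH1 _ IH2 r].
- rewrite inversions_dihedral iotaD map_cat count_cat add0n.
  rewrite -{2}[m s t]addn0 iotaDl -map_comp.
  rewrite (eq_map (g := fun j => (gen s * gen t) ^+ j * gen s)).
    by rewrite oddD addbb.
  by move=> j /=; rewrite expgnDr cox_gen_rel mul1g.
- by [].
- by rewrite IH.
- by rewrite IH1.
- rewrite !inversions_cat !count_cat !oddD IH1 !count_inversions_conj.
  by rewrite (proj2 (word_classP _ _ _) uu1) IH2.
Qed.

Lemma delete_inversion u r : r \in inversions u ->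
  exists a t b, u = a ++ t :: b /\ r * cl u = cl (a ++ b).
Proof.
elim: u r => [//|s u IHu] r /=; rewrite inE => /orP[/eqP->|/mapP[x /IHu]].
  by exists [::], s, u; rewrite word_class_cons cox_gen_mulK.
move=> [a [t [b [-> E]]]] ->; exists (s :: a), t, b; split=> //=.
by rewrite !word_class_cons -E conjgE !cox_genV -!mulgA cox_gen_mulK.
Qed.

Lemma cox_length_le u : cox_length (cl u) <= size u.
Proof.
rewrite /cox_length; case: ex_minnP => k _; apply.
by apply/asboolP; exists u => //; rewrite /expression_of word_prodE.
Qed.

Lemma cox_length_word w : exists u, cl u = w /\ size u = cox_length w.
Proof.
have [u [E L]] := reduced_expression_exists w.
by exists u; rewrite -word_prodE.
Qed.

(** Multiplication by [s] changes the parity of [s] among the inversions. If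
    [s] is not an inversion of [u], it is one of every word [v] of [s u]; when
    [v] is reduced, deleting a letter of [v] then makes the length of [u]
    smaller than that of [s u]. *)
Lemma exchange s u : cox_length (gen s * cl u) <= cox_length (cl u) ->
  exists a t b, u = a ++ t :: b /\ gen s * cl u = cl (a ++ b).
Proof.
move=> le_su; apply: delete_inversion; case: (boolP (_ \in _)) => // s_u.
have [v [Ev Lv]] := cox_length_word (gen s * cl u).
have /delete_inversion[a [t [b [Dv E]]]] : gen s \in inversions v.
  suff: odd (count_mem (gen s) (inversions v)).
    by rewrite -has_pred1 has_count; case: count.
  rewrite -(@odd_inversions (s :: u)); last first.
    by apply/word_classP; rewrite word_class_cons.
  rewrite /= eqxx count_inversions_conj conjgE mulKg.
  by rewrite (count_memPn s_u).
have := cox_length_le (a ++ b); rewrite -E Ev cox_gen_mulK leqNgt.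
suff -> : size (a ++ b) < cox_length (cl u) by [].
by apply: leq_trans le_su; rewrite -Lv Dv !size_cat addnS.
Qed.

End Exchange.

(** * Commutation classes *)

Section Commutation.
Variables (S : finType) (m : coxeter_matrix S).
Implicit Types (u v : seq S) (s t : S).

Lemma comm_equiv_cat a b u v :
  comm_equiv m u v -> comm_equiv m (a ++ u ++ b) (a ++ v ++ b).
Proof.
elim=> [_ _ [x y s t st]|x|x y z _ IH1 _ IH2];
  [|exact: rt_refl|exact: rt_trans IH1 IH2].
by apply: rt_step; rewrite -!catA !(catA a x); apply: CommMove.
Qed.

Lemma comm_equiv_catl a u v :
  comm_equiv m u v -> comm_equiv m (a ++ u) (a ++ v).
Proof. by move=> /(comm_equiv_cat a [::]); rewrite !cats0. Qed.

Lemma comm_equiv_cons s u v :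
  comm_equiv m u v -> comm_equiv m (s :: u) (s :: v).
Proof. exact: (comm_equiv_catl [:: s]). Qed.

Lemma comm_equiv_swap s t u :
  m s t = 2 -> comm_equiv m [:: s, t & u] [:: t, s & u].
Proof. by move=> st; apply: rt_step; apply: (CommMove [::]). Qed.

Lemma comm_equiv_sym u v : comm_equiv m u v -> comm_equiv m v u.
Proof.
elim=> [_ _ [x y s t st]|x|x y z _ IH1 _ IH2];
  [|exact: rt_refl|exact: rt_trans IH2 IH1].
by apply: rt_step; apply: CommMove; rewrite coxm_sym.
Qed.

Lemma comm_equiv_perm u v : comm_equiv m u v -> perm_eq u v.
Proof.
elim=> [_ _ [x y s t st]|x|x y z _ IH1 _ IH2] //;
  last exact: perm_trans IH1 IH2.
by rewrite perm_cat2l perm_cat2r (perm_catC [:: s] [:: t]).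
Qed.

Lemma comm_equiv_front s a u :
  all (fun t => m s t == 2) a -> comm_equiv m (a ++ s :: u) (s :: a ++ u).
Proof.
elim: a => [_|t a IHa /= /andP[/eqP st /IHa IH]]; first exact: rt_refl.
apply: (rt_trans _ _ _ (t :: s :: a ++ u)); first exact: comm_equiv_cons.
by apply: comm_equiv_swap; rewrite coxm_sym.
Qed.

Lemma projections_comm_equiv u v s t : comm_equiv m u v -> m s t != 2 ->
  [seq x <- u | x \in [:: s; t]] = [seq x <- v | x \in [:: s; t]].
Proof.
move=> uv mst; elim: uv => [_ _ [a b x y xy]|//|x y z _ -> _ -> //].
rewrite !filter_cat /=; congr (_ ++ _ ++ _).
case: ifP => //; case: ifP => //; rewrite !inE => y_st x_st.
case/orP: x_st xy => /eqP->; case/orP: y_st => /eqP->; rewrite ?coxm_diag //.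
  by move/eqP; rewrite (negbTE mst).
by rewrite coxm_sym => /eqP; rewrite (negbTE mst).
Qed.
(** The order of two occurrences matters only when their
    letters do not commute, so a commutation class is known from the words
    read on all pairs of non-commuting letters. If [u] starts with [s], the
    letters in front of the first occurrence of [s] in [v] commute with [s],
    since otherwise one of them would come first in a projection where [s]
    comes first. *)
Lemma comm_equiv_projections u v :
  (forall s t, m s t != 2 ->
     [seq x <- u | x \in [:: s; t]] = [seq x <- v | x \in [:: s; t]]) ->
  comm_equiv m u v.
Proof.
elim: u v => [|s u IHu] v E.
  case: v E => [_|x v /(_ x x)]; first exact: rt_refl.
  by rewrite coxm_diag /= inE eqxx => /(_ isT).
have /has_split_first[a [x [b [Dv /eqP xs s_a]]]] : has (pred1 s) v.
  have := E s s; rewrite coxm_diag /= inE eqxx has_pred1 => /(_ isT) Es.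
  have: s \in [seq x <- v | x \in [:: s; s]] by rewrite -Es mem_head.
  by rewrite mem_filter => /andP[].
rewrite {x}xs in Dv; rewrite {v}Dv in E *; rewrite has_pred1 in s_a.
have com_a : all (fun t => m s t == 2) a.
  apply/negPn; rewrite -has_predC; apply/negP.
  move=> /has_split_first[a1 [t [a2 [Da /= ms a1t]]]].
  have := E s t ms; rewrite Da -catA /= !filter_cat /= !inE !eqxx orbT /=.
  suff -> : [seq x <- a1 | x \in [:: s; t]] = [::].
    by case=> st; rewrite Da mem_cat inE st eqxx orbT in s_a.
  apply/eqP; rewrite -[_ == _]negbK -has_filter; apply/hasPn => x xa1.
  rewrite !inE; apply/norP; split.
    by apply: contraNneq s_a => <-; rewrite Da mem_cat xa1.
  by apply: contraNneq a1t => xt; apply/hasP; exists x; rewrite //= xt.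
apply: rt_trans (comm_equiv_sym (comm_equiv_front b com_a)).
apply/comm_equiv_cons/IHu => x y xy; have := E x y xy.
rewrite /= !filter_cat /=; case: ifP => [sxy|//].
suff -> : [seq z <- a | z \in [:: x; y]] = [::] by case.
apply/eqP; rewrite -[_ == _]negbK -has_filter; apply/hasPn => z za.
have sz := allP com_a z za; apply: contraTN sxy => zxy.
have {}zs : z != s by apply: contraNneq s_a => <-.
apply: contraL sz => sxy; move: xy zs; move: sxy zxy.
rewrite !inE => /orP[] /eqP-> /orP[] /eqP->; rewrite ?eqxx //.
by rewrite coxm_sym.
Qed.

End Commutation.

(** * Fully commutative elements of simply laced groups *)

Section BraidFree.
Variables (S : finType) (m : coxeter_matrix S).
Local Notation cl := (word_class m).
Implicit Types (u v : seq S) (s t : S).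

Definition braid_free u :=
  forall v a b s t, comm_equiv m u v ->
    v <> a ++ [:: s; s] ++ b /\ (m s t = 3 -> v <> a ++ [:: s; t; s] ++ b).

Lemma braid_free_equiv u v : comm_equiv m u v -> braid_free u -> braid_free v.
Proof. by move=> uv Fu x a b s t vx; apply: Fu; apply: rt_trans uv vx. Qed.

Lemma braid_free_behead s u : braid_free (s :: u) -> braid_free u.
Proof.
move=> Fu v a b x t /(comm_equiv_cons s) uv.
have [N1 N2] := Fu _ (s :: a) b x t uv.
by split=> [E|mxt E]; [apply: N1 | apply: N2 mxt _]; rewrite E.
Qed.

Lemma comm_equiv_class u v : comm_equiv m u v -> cl u = cl v.
Proof.
elim=> [_ _ [x y s t st]|x|x y z _ -> _ -> //] //.
rewrite !word_class_cat; congr (_ * (_ * _))%g.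
have E := cox_gen_rel m s t; rewrite st expgS expg1 in E.
rewrite !word_class_cons word_class_nil !mulg1.
apply: (mulgI (cox_gen m s * cox_gen m t)%g).
by rewrite E -!mulgA !cox_gen_mulK cox_gen_sqr.
Qed.

Lemma cox_gen_braid s t : m s t = 3 ->
  cl [:: s; t; s] = cl [:: t; s; t].
Proof.
move=> st; have E := cox_gen_rel m s t; rewrite st !expgS expg0 mulg1 in E.
rewrite !word_class_cons word_class_nil !mulg1.
apply: (mulIg (cl [:: t; s; t])); rewrite !word_class_cons word_class_nil mulg1.
by rewrite -!mulgA !cox_gen_mulK cox_gen_sqr -E -!mulgA.
Qed.

Definition reduced u := size u = cox_length (cl u).

Lemma reduced_class u v :
  reduced u -> cl u = cl v -> size v = size u -> reduced v.
Proof. by rewrite /reduced => -> -> ->. Qed.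

Lemma reduced_behead s u : reduced (s :: u) -> reduced u.
Proof.
move=> Ru; apply/eqP; rewrite eqn_leq cox_length_le andbT.
have [v [Ev Lv]] := cox_length_word (cl u).
have := cox_length_le m (s :: v).
by rewrite word_class_cons Ev -word_class_cons -Ru /= Lv.
Qed.

(** The easy half of Stembridge's criterion: the factor [ss] shortens a word,
    and exchanging [sts] for [tst] changes the number of letters [s], which
    commutations preserve. *)
Lemma fully_commutative_braid_free w u :
  fully_commutative m w -> reduced_expression_of w u -> braid_free u.
Proof.
move=> FC [Eu Lu] v a b s t uv; have Ev := comm_equiv_class uv.
have Lv := perm_size (comm_equiv_perm uv).
split=> [Dv|st Dv].
  have := cox_length_le m (a ++ b); rewrite leqNgt.
  suff -> : size (a ++ b) < cox_length (cl (a ++ b)) by [].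
  have -> : cl (a ++ b) = w.
    rewrite -Eu word_prodE Ev Dv !word_class_cat; congr (_ * _)%g.
    by rewrite !word_class_cons word_class_nil mulg1 cox_gen_sqr mul1g.
  by rewrite -Lu Lv Dv !size_cat /= !addnS ltnS leqnSn.
have Ru : reduced_expression_of w v.
  by split; [rewrite /expression_of -Eu !word_prodE Ev | rewrite -Lv].
have R' : reduced_expression_of w (a ++ [:: t; s; t] ++ b).
  split; last by rewrite -Lu Lv Dv !size_cat.
  rewrite /expression_of -Eu !word_prodE Ev Dv !word_class_cat.
  by rewrite (cox_gen_braid st).
have := comm_equiv_perm (FC _ _ Ru R'); rewrite Dv perm_cat2l perm_cat2r.
have nst : s != t by apply/eqP => E; move: st; rewrite E coxm_diag.
by move/seq.permP/(_ (pred1 s)); rewrite /= !eqxx eq_sym (negbTE nst).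
Qed.

(** The other half of Stembridge's criterion. Let [s u] be braid-free and write
    another reduced word of the same element as [t v] with [t != s]. Exchange
    gives a word [t s u2] of this element. If [s] and [t] commute, induction
    on the length shows that [u] is commutation equivalent to [t u2], and [v]
    to [s u2]. Otherwise a second exchange gives a word [s t s u3], and by
    induction [u] is commutation equivalent to [t s u3], so that the class of
    [s u] contains a word with a factor [sts]. *)
Lemma braid_free_unique u :
  (forall s t, s != t -> (m s t == 2) || (m s t == 3)) ->
  injective (cox_gen m) -> braid_free u ->
  reduced u /\ forall v, reduced v -> cl u = cl v -> comm_equiv m u v.
Proof.
move=> simply_laced gen_inj.
have gen_neq1 x y : x != y -> (cox_gen m x * cox_gen m y)%g <> 1%g.
  move=> /eqP nxy xy; apply/nxy/gen_inj.
  by rewrite -[LHS]mulg1 -(cox_gen_sqr m y) mulgA xy mul1g.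
have [k] := ubnP (size u); elim: k u => [//|k IHk] [_ _|s u].
  split=> [|v]; first by apply/eqP; rewrite eqn_leq cox_length_le.
  rewrite /reduced => Rv E; have := cox_length_le m [::]; rewrite E -Rv.
  by case: v {Rv E} => // _; apply: rt_refl.
rewrite ltnS /= => lt_k Fsu; have Fu := braid_free_behead Fsu.
have [Ru Uu] := IHk _ lt_k Fu.
have Rsu : reduced (s :: u).
  apply/eqP; rewrite eqn_leq cox_length_le andbT /= ltnNge; apply/negP.
  rewrite Ru word_class_cons => /exchange[a [t [b [Du E]]]].
  have Esab : cl u = cl (s :: a ++ b).
    by rewrite word_class_cons -E cox_gen_mulK.
  have Rsab : reduced (s :: a ++ b).
    by apply: (reduced_class Ru) => //; rewrite Du /= !size_cat addnS.
  have /(comm_equiv_cons s) C := Uu _ Rsab Esab.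
  by have [] := Fsu _ [::] (a ++ b) s s C.
split=> // [[|t v]] Rv E.
  by have := Rsu; rewrite /reduced E -Rv.
have size_vu : size v = size u by apply: succn_inj; rewrite [RHS]Rsu E -Rv.
have Rv' := reduced_behead Rv.
have [Dt|nst] := eqVneq s t.
  rewrite -Dt !word_class_cons in E *.
  by apply/comm_equiv_cons/Uu => //; apply: mulgI E.
(* The letter [t] is a descent of [s u]. Exchange cannot delete [s], since this
   would identify the generators [s] and [t]. *)
have Etsu : (cox_gen m t * cl (s :: u))%g = cl v.
  by rewrite E word_class_cons cox_gen_mulK.
have [a [x [b [Dsu Ets]]]] : exists a x b, s :: u = a ++ x :: b /\
    (cox_gen m t * cl (s :: u))%g = cl (a ++ b).
  by apply: exchange; rewrite Etsu -Rsu /= -size_vu leqW // cox_length_le.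
case: a Dsu Ets => [|z a] [].
  move=> _ <-; rewrite word_class_cons mulgA -{2}[cl u]mul1g => /mulIg.
  by case/gen_neq1; rewrite eq_sym.
move=> <- Du; rewrite cat_cons => Ets.
set u2 := a ++ b in Ets.
have size_u2 : (size u2).+1 = size u by rewrite Du !size_cat addnS.
have Ets' : cl (s :: u) = cl [:: t, s & u2].
  by rewrite (word_class_cons m t) -Ets cox_gen_mulK.
case/orP: (simply_laced _ _ nst) => /eqP mst.
  have Est : cl (s :: u) = cl [:: s, t & u2].
    rewrite Ets'; apply/comm_equiv_class/comm_equiv_swap.
    by rewrite coxm_sym.
  have Ctu : comm_equiv m u (t :: u2).
    apply: Uu; first apply: (@reduced_behead s).
      by apply: (reduced_class Rsu) => //=; rewrite size_u2.
    by apply: (mulgI (cox_gen m s)); rewrite -!word_class_cons Est.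
  have Csu : comm_equiv m (s :: u) [:: t, s & u2].
    by apply: rt_trans (comm_equiv_cons s Ctu) (comm_equiv_swap u2 mst).
  apply: rt_trans (Csu) _; apply: comm_equiv_cons.
  have Fsu2 := braid_free_behead (braid_free_equiv Csu Fsu).
  have [|_ Usu] := IHk (s :: u2) _ Fsu2; first by rewrite /= size_u2.
  apply: Usu => //; apply: (mulgI (cox_gen m t)).
  by rewrite -!word_class_cons -Ets'.
(* Now [s] is a descent of [t s u2]; deleting one of the first two letters would
   identify two generators, and deleting a later one exhibits [s t s]. *)
have [c [x' [d [Dy Ey]]]] : exists c y d, [:: t, s & u2] = c ++ y :: d /\
    (cox_gen m s * cl [:: t, s & u2])%g = cl (c ++ d).
  apply: exchange; rewrite -Ets' word_class_cons cox_gen_mulK -Ru.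
  by rewrite -word_class_cons -Rsu.
rewrite word_class_cons in Ey.
case: c Dy Ey => [|? [|? c]] /= [].
- move=> _ <-; rewrite mulgA -{2}[cl _]mul1g => /mulIg.
  by case/gen_neq1.
- move=> <- _ <-; rewrite !word_class_cons !mulgA => /mulIg.
  have := cox_gen_braid mst.
  rewrite !word_class_cons word_class_nil !mulg1 !mulgA => ->.
  by rewrite -mulgA -[RHS]mulg1 => /mulgI; case/gen_neq1.
- move=> <- <- Du2; rewrite !word_class_cons => Ey.
  have Eu : cl u = cl [:: t, s & c ++ d].
    apply: (mulgI (cox_gen m s)); rewrite -word_class_cons Ets'.
    rewrite [in RHS]word_class_cons -[RHS](cox_gen_mulK s) !word_class_cons.
    by rewrite -Ey !cox_gen_mulK.
  have Ru' : reduced [:: t, s & c ++ d].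
    by apply: (reduced_class Ru Eu); rewrite -size_u2 Du2 /= !size_cat addnS.
  have [_] := Fsu _ [::] (c ++ d) s t (comm_equiv_cons s (Uu _ Ru' Eu)).
  by case.
Qed.

Lemma braid_free_fully_commutative u :
  (forall s t, s != t -> (m s t == 2) || (m s t == 3)) ->
  injective (cox_gen m) -> braid_free u ->
  reduced_expression_of (cl u) u /\ fully_commutative m (cl u).
Proof.
move=> simply_laced gen_inj /(braid_free_unique simply_laced gen_inj)[Ru Uu].
split; first by split; [exact: word_prodE|].
have E v : reduced_expression_of (cl u) v -> comm_equiv m u v.
  move=> [Ev Lv]; rewrite /expression_of word_prodE in Ev.
  by apply: Uu; rewrite /reduced Ev.
by move=> v v' /E/comm_equiv_sym uv /E; apply: rt_trans uv.
Qed.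
End BraidFree.

(** * Alternating words in affine type A *)

Section AlternatingWords.
Variables (n : nat) (n_ge3 : 2 < n).
Local Notation Z := 'Z_n.
Local Notation m := (affA n).
Local Notation chain u s := [seq x <- u | x \in [:: s; (s + 1)%R]].
Implicit Types (s t x : Z) (u v a b c : seq Z).
Local Open Scope ring_scope.
Import GRing.Theory.

Lemma Zn_nat_eq0 k : (0 < k < n)%N -> (k%:R : Z) != 0.
Proof.
move=> /andP[k_gt0 k_lt].
rewrite -val_eqE /= val_Zp_nat ?(ltn_trans _ n_ge3) //.
by rewrite modn_small // -lt0n.
Qed.

Lemma Zn_1_neq0 : (1 : Z) != 0.
Proof. by rewrite -[1]/(1%:R) Zn_nat_eq0 // (ltn_trans _ n_ge3). Qed.

Lemma Zn_2_neq0 : (1 + 1 : Z) != 0.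
Proof. by rewrite -[1 + 1]/(2%:R) Zn_nat_eq0. Qed.

Lemma Zn_add1_neq s : s + 1 != s.
Proof. by rewrite -subr_eq0 (addrC s) addrK Zn_1_neq0. Qed.

Lemma Zn_add2_neq s : s + 1 + 1 != s.
Proof. by rewrite -(addrA s) -subr_eq0 (addrC s) addrK Zn_2_neq0. Qed.

Lemma affA_add1 s : m s (s + 1) = 3%N.
Proof.
by rewrite /= /affA_m eq_sym (negbTE (Zn_add1_neq s)) /cyc_adj /= eqxx.
Qed.

Lemma affA_eq2 s t : (m s t == 2) = [&& t != s, t != s + 1 & t != s - 1].
Proof.
rewrite /= /affA_m /cyc_adj /= [t == s]eq_sym [t == s - 1]eq_sym subr_eq.
by case: (s == t); case: (t == s + 1); case: (s == t + 1).
Qed.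

Lemma affA_simply_laced s t : s != t -> (m s t == 2%N) || (m s t == 3%N).
Proof. by rewrite /= /affA_m => /negbTE->; case: ifP. Qed.

(** The generators are told apart by the action of [W] on Z/nZ through the
    transpositions of cyclically adjacent points. *)
Lemma affA_gen_inj : injective (cox_gen m).
Proof.
pose f s : {perm Z} := tperm s (s + 1).
have f_inj : injective f.
  move=> s t /(congr1 (fun g : {perm Z} => g s)); rewrite /f tpermL.
  case: tpermP => [-> //|Es /esym Et|_ _ Es].
    by have := Zn_add2_neq s; rewrite -Et -Es eqxx.
  by have := Zn_add1_neq s; rewrite Es eqxx.
have f_braid (x y z : Z) : x != y -> y != z -> x != z ->
    ((tperm x y * tperm y z) ^+ 3 = 1)%g.
  move=> xy yz xz; rewrite !expgS expg0 mulg1.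
  have E1 : (tperm x y * tperm y z * tperm x y)%g = tperm x z.
    have := tpermJ y z (tperm x y); rewrite tpermR tpermD //.
    by rewrite conjgE tpermV mulgA.
  have E2 : (tperm y z * tperm x y * tperm y z)%g = tperm x z.
    have := tpermJ x y (tperm y z); rewrite tpermL tpermD 1?[_ == x]eq_sym //.
    by rewrite conjgE tpermV mulgA.
  by rewrite !mulgA E1 -!mulgA (mulgA (tperm y z)) E2 tperm2.
have f_rel s t : ((f s * f t) ^+ m s t = 1)%g.
  case: (eqVneq s t) => [->|nst]; first by rewrite coxm_diag expg1 tperm2.
  rewrite /= /affA_m (negbTE nst) /cyc_adj /=.
  case: eqVneq => [->|ts] /=.
    by rewrite f_braid // eq_sym ?Zn_add1_neq ?Zn_add2_neq.
  case: eqVneq => [->|st] /=.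
    by rewrite /f tpermC (tpermC t) f_braid ?Zn_add1_neq ?Zn_add2_neq.
  have C : (f t * f s = f s * f t)%g.
    rewrite conjgC {2}/f tpermJ !tpermD // 1?eq_sym //.
    by rewrite (inj_eq (addIr 1)) eq_sym.
  by rewrite expgS expg1 -{1}C -mulgA (mulgA (f s)) tperm2 mul1g tperm2.
have [F [_ EF]] := coxeter_group_universal f_rel.
by move=> s t st; apply: f_inj; rewrite -!EF st.
Qed.

Definition alternating u := forall s, sorted (fun x y => x != y) (chain u s).

Lemma alternating_equiv u v :
  comm_equiv m u v -> alternating u -> alternating v.
Proof.
by move=> uv Au s; rewrite -(projections_comm_equiv uv) // affA_add1.
Qed.

(** In a factor [ss], or [sts] where [t] is one neighbour of [s], the two
    letters [s] are consecutive in the chain that involves the other neighbour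
    of [s]; as [n >= 3], that neighbour is not [t]. *)
Lemma alternating_braid_free u : alternating u -> braid_free m u.
Proof.
move=> Au v a b s t /alternating_equiv/(_ Au){u Au} Av.
have key x c' : s \in [:: x; x + 1] -> ~~ has (mem [:: x; x + 1]) c' ->
    v <> a ++ [:: s] ++ c' ++ [:: s] ++ b.
  move=> sx c'x Dv; have := Av x; rewrite Dv !filter_cat [filter _ [:: s]]/=.
  have -> : [seq y <- c' | y \in [:: x; x + 1]] = [::].
    by apply/eqP; rewrite -[_ == _]negbK -has_filter.
  by rewrite sx => /cat_sorted2[_] /=; rewrite eqxx.
split; first by apply: (key s [::]); rewrite ?mem_head.
rewrite /= /affA_m /cyc_adj /=; case: (s == t) => //.
case: (eqVneq t (s + 1)) => [->|_] /=.
  move=> _; apply: (key (s - 1) [:: s + 1]).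
    by rewrite subrK !inE eqxx orbT.
  rewrite /= subrK !inE (negbTE (Zn_add1_neq _)) !orbF.
  by rewrite -(inj_eq (addIr 1)) subrK; apply: Zn_add2_neq.
case: (eqVneq s (t + 1)) => [Es|//] _.
apply: (key s [:: t]); first exact: mem_head.
rewrite /= !inE orbF Es [_ == t + 1]eq_sym (negbTE (Zn_add1_neq _)) /= eq_sym.
exact: Zn_add2_neq.
Qed.

(** Two consecutive [s] with no [s + d] between them enclose at most one
    [s - d], which gives a factor [ss] or [s (s-d) s] up to commutations, or
    two consecutive [s - d] with no [s] between them, which is the same
    situation on a shorter stretch. *)
Lemma not_braid_free_gap d s a b c : d = 1 \/ d = - 1 ->
  s \notin b -> s + d \notin b -> ~ braid_free m (a ++ s :: b ++ s :: c).
Proof.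
move=> Hd; have [k] := ubnP (size b); elim: k s a b c => // k IHk s a b c.
rewrite ltnS => le_bk sb sdb.
have comm b' : {subset b' <= b} -> s - d \notin b' ->
    all (fun t => m s t == 2%N) b'.
  move=> b'b sdb'; apply/allP => x xb'; rewrite affA_eq2.
  have -> : x != s by apply: contraNneq sb => <-; apply: b'b.
  have : x != s + d by apply: contraNneq sdb => <-; apply: b'b.
  have : x != s - d by apply: contraNneq sdb' => <-.
  by case: Hd => ->; rewrite ?opprK => -> ->.
case: (boolP (has (pred1 (s - d)) b)); rewrite has_pred1; last first.
  move=> sdb' Fu.
  have [] := Fu (a ++ [:: s; s] ++ b ++ c) a (b ++ c) s s; last by [].
  exact/comm_equiv_catl/comm_equiv_cons/comm_equiv_front/comm.
rewrite -has_pred1 => /has_split_first[b1 [x [b2 [Db /eqP Ex]]]].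
rewrite {x}Ex in Db *.
rewrite has_pred1 => b1_sd.
case: (boolP (has (pred1 (s - d)) b2)); rewrite has_pred1; last first.
  move=> b2_sd Fu.
  have [|_] := Fu (a ++ b1 ++ [:: s; s - d; s] ++ b2 ++ c)
                  (a ++ b1) (b2 ++ c) s (s - d).
    apply: comm_equiv_catl; rewrite Db -catA.
    apply: (rt_trans _ _ _ (s :: b1 ++ [:: s - d, s & b2 ++ c])).
      apply/comm_equiv_cons/comm_equiv_catl/comm_equiv_cons/comm_equiv_front.
      by apply: comm b2_sd => y yb2; rewrite Db mem_cat inE yb2 !orbT.
    apply/comm_equiv_sym/comm_equiv_front.
    by apply: comm b1_sd => y yb1; rewrite Db mem_cat yb1.
  rewrite -!catA; apply=> //.
  case: Hd => ->; rewrite ?opprK ?affA_add1 //.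
  by rewrite coxm_sym -{2}(subrK 1 s) affA_add1.
rewrite -has_pred1 => /has_split_first[b' [x [b3 [Db2 /eqP Ex]]]].
rewrite {x}Ex in Db2 *.
rewrite has_pred1 => b'_sd.
have -> : a ++ s :: b ++ s :: c =
    (a ++ s :: b1) ++ (s - d) :: b' ++ (s - d) :: (b3 ++ s :: c).
  by rewrite Db Db2 /= -!catA /= -!catA.
apply: IHk => //.
  apply: leq_trans le_bk; rewrite Db Db2 !size_cat /= !size_cat /=.
  by rewrite !addnS !ltnS -!addnS addnCA leq_addr.
rewrite subrK; apply: contra sb => sb'.
by rewrite Db Db2 !(mem_cat, inE) sb' !orbT.
Qed.

Lemma braid_free_alternating u : braid_free m u -> alternating u.
Proof.
move=> Fu s; apply/negPn/negP => /not_sorted_neq[a [x [b [c [Du xs]]]]].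
rewrite -all_predC => /allP bs.
have nb y : y \in [:: s; s + 1] -> y \notin b.
  by move=> ys; apply/negP => /bs /=; rewrite ys.
suff [d Hd xd] : exists2 d, d = 1 \/ d = - 1 & x + d \in [:: s; s + 1].
  by apply: (@not_braid_free_gap d x a b c) => //; rewrite ?nb // -Du.
move: xs; rewrite !inE => /orP[] /eqP->.
  by exists 1; [left | rewrite !inE eqxx orbT].
by exists (-1); [right | rewrite !inE addrK eqxx].
Qed.

End AlternatingWords.

(** * Heaps and the walk of an alternating word *)

Section HeapProjection.
Variables (S : finType) (Gamma : rel S).
Implicit Types (u v : seq S) (s t : S).

Lemma label_count_heap u s : label_count (Heap Gamma u) s = count_mem s u.
Proof.
rewrite /label_count /= -[RHS]/(count_mem s (tval (in_tuple u))).
by rewrite -map_tnth_enum count_map cardE size_filter enumT; apply: eq_count.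
Qed.

Lemma connect_heap_leq u (i j : 'I_(size u)) :
  connect (heap_cover Gamma (u := u)) i j -> i <= j.
Proof.
case/connectP => p; elim: p i => [|k p IHp] i /=; first by move=> _ ->.
by case/andP => /andP[/ltnW ik _] /IHp{}IHp /IHp; apply: leq_trans.
Qed.

(** The heap order refines the order of the positions in [u], so the lowest
    element of a chain is its first letter in [u]. *)
Lemma lowest_label u s t :
  symmetric Gamma -> Gamma s t -> has [in [:: s; t]] u ->
  [exists x : Heap Gamma u,
     is_lowest (Heap Gamma u) s t x && (lp_label (Heap Gamma u) x == t)] =
  (head s [seq x <- u | x \in [:: s; t]] == t).
Proof.
move=> Gsym Gst ust.
have lowestE x : is_lowest (Heap Gamma u) s t x ->
    lp_label (Heap Gamma u) x = head s [seq x <- u | x \in [:: s; t]].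
  case/andP => xst /forall_inP low_x.
  have lt_f : find [in [:: s; t]] u < size u by rewrite -has_find.
  have Ef : nth s u (find [in [:: s; t]] u) =
      head s [seq x <- u | x \in [:: s; t]].
    by elim: (u) ust => //= y v IHv; case: ifP.
  rewrite -Ef /= (tnth_nth s); congr nth; apply/eqP.
  rewrite eqn_leq; apply/andP; split.
    apply: (connect_heap_leq (j := Ordinal lt_f)); apply: low_x.
    by rewrite /= (tnth_nth s) /=; have := nth_find s ust.
  rewrite leqNgt; apply/negP => /(before_find s) /=.
  by rewrite -(tnth_nth s (in_tuple u)) xst.
have [x0 low0] := Heap_lowest Gsym Gst ust.
apply/existsP/eqP => [[x /andP[/lowestE <- /eqP]] //|E].
by exists x0; rewrite low0 lowestE // E eqxx.
Qed.

End HeapProjection.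

Section Walks.
Variables (n : nat) (n_ge3 : 2 < n).
Local Notation Z := 'Z_n.
Local Notation m := (affA n).
Local Notation heap := (Heap (coxeter_graph m)).
Local Notation chain u s := [seq x <- u | x \in [:: s; (s + 1)%R]].
Implicit Types (s t x : Z) (u v : seq Z) (h : Z -> nat) (o : Z -> bool).
Import GRing.Theory.

(** Local conditions satisfied by the heights [h] of an alternating word and by
    the orientations [o], where [o s] means that the chain on [s] and [s + 1]
    starts with [s + 1]. Where both heights vanish [o s] is free, unlike the
    label of the step; this makes the conditions stable when a letter is
    removed. *)
Definition valid_config h o := forall s,
  if o s then (h s <= h (s + 1)%R <= (h s).+1)
  else (h (s + 1)%R <= h s <= (h (s + 1)%R).+1).

Definition realizes u h o :=
  (forall s, count_mem s u = h s) /\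
  (forall s, chain u s = altseq (h s + h (s + 1)%R)
     (if o s then (s + 1)%R else s) (if o s then s else (s + 1)%R)).

Lemma realizes_alternating u h o : realizes u h o -> alternating u.
Proof.
move=> [_ Pu] s; rewrite Pu; apply: sorted_altseq.
by case: (o s); rewrite 1?[s == _]eq_sym Zn_add1_neq.
Qed.

Lemma count_projection u s t : s != t ->
  size [seq x <- u | x \in [:: s; t]] = (count_mem s u + count_mem t u).
Proof.
move=> st; rewrite size_filter -count_predUI -[LHS]addn0; congr addn.
  by apply: eq_count => x; rewrite /= !inE.
apply/esym/eqP; rewrite -leqn0 leqNgt -has_count; apply/hasPn => x _ /=.
by case: eqP => // ->.
Qed.

Lemma alternating_realizes u : alternating u ->
  realizes u (fun s => count_mem s u)
    (fun s => head s (chain u s) == (s + 1)%R).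
Proof.
move=> Au; split=> // s.
have nss : s != (s + 1)%R by rewrite eq_sym Zn_add1_neq.
have fab : {subset chain u s <= [:: s; (s + 1)%R]}.
  by move=> x; rewrite mem_filter => /andP[].
rewrite -count_projection //; set f := [seq x <- u | _] in fab *.
have Af : sorted (fun x y => x != y) f := Au s.
case: eqP => E; apply: altseq_sorted => //.
- by move=> x /fab; rewrite !inE orbC.
- by case: (f) E.
- case: (f) E fab => //= x f' E /(_ x (mem_head _ _)).
  by rewrite !inE => /orP[] /eqP.
Qed.

Lemma realizes_valid u h o : realizes u h o -> valid_config h o.
Proof.
move=> [Cu Pu] s; have nss : s != (s + 1)%R by rewrite eq_sym Zn_add1_neq.
have cE x : x \in [:: s; (s + 1)%R] ->
    h x = count_mem x (altseq (h s + h (s + 1)%R)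
      (if o s then (s + 1)%R else s) (if o s then s else (s + 1)%R)).
  move=> xs; rewrite -Pu -Cu count_filter; apply: eq_count => y /=.
  by case: eqP => // ->; rewrite xs.
have half_le k : k./2 <= uphalf k <= (k./2).+1.
  by rewrite uphalf_half; case: odd; rewrite /= ?add0n ?add1n leqnn ?leqnSn.
have := cE s (mem_head _ _); have := cE (s + 1)%R (mem_last s [:: (s + 1)%R]).
set k := (_ + _); case: (o s).
  by have [|-> ->] := @count_altseq _ k (s + 1)%R s; rewrite 1?eq_sym // => -> ->.
by have [|-> ->] := @count_altseq _ k s (s + 1)%R; rewrite // => -> ->.
Qed.

Lemma coxeter_graph_affA_sym : symmetric (coxeter_graph m).
Proof. by move=> s t; rewrite /coxeter_graph /= eq_sym affA_m_sym. Qed.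

Lemma phi_label_realizes u h o i : realizes u h o ->
  phi_label (heap u) i =
    (if h i%:R%R != h (i%:R + 1)%R then None
     else if (h i%:R%R == 0) || o i%:R%R then Some L else Some R).
Proof.
move=> [Cu Pu]; rewrite /phi_label !label_count_heap -natr1 !Cu.
case: eqP => //= h_eq; case: eqP => //= /eqP h0.
have nss : i%:R%R != (i%:R + 1)%R :> Z by rewrite eq_sym Zn_add1_neq.
rewrite lowest_label; first last.
- by rewrite has_filter Pu -h_eq; case: (h i%:R%R) h0.
- by rewrite /coxeter_graph /= nss; have := affA_add1 n_ge3 i%:R%R => /= ->.
- exact: coxeter_graph_affA_sym.
rewrite Pu -h_eq; case: (h i%:R%R) h0 => //= k _.
by case: (o _); rewrite ?eqxx // (negbTE nss).
Qed.

Lemma wpt_heap (H : labelled_poset Z) k : (k <= n) ->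
  wpt (walk_of_heap H) k = (k, label_count H k%:R%R).
Proof. by move=> kn; rewrite /wpt /= ffunE /= inordK. Qed.

Lemma Zn_natr s : s = ((val s)%:R)%R.
Proof. by rewrite natr_Zp. Qed.

Lemma ltn_Zn s : (val s < n).
Proof. by have := ltn_ord s; rewrite [X in (_ < X) -> _]Zp_cast // ltnW. Qed.

Lemma Zn_natn : (n%:R = 0 :> Z)%R.
Proof. by apply: val_inj; rewrite /= val_Zp_nat ?modnn // ltnW. Qed.

Lemma walk_of_heap_realizes u v h o : realizes u h o -> realizes v h o ->
  walk_of_heap (heap u) = walk_of_heap (heap v).
Proof.
move=> Ru Rv; congr Prewalk; apply/ffunP => i; rewrite !ffunE.
  by rewrite !label_count_heap; have [-> _] := Ru; have [-> _] := Rv.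
by rewrite (phi_label_realizes _ Ru) (phi_label_realizes _ Rv).
Qed.

Lemma realizes_comm_equiv u v h o :
  comm_equiv m u v -> realizes u h o -> realizes v h o.
Proof.
move=> uv [Cu Pu]; split=> s.
  by rewrite -Cu; have /comm_equiv_perm/seq.permP-> := uv.
by rewrite -(projections_comm_equiv uv) // affA_add1.
Qed.

(** Unequal heights determine which letter starts, and ends, the chain. *)
Lemma realizes_chain_eq u v h ou ov s :
  realizes u h ou -> realizes v h ov ->
  (h s = h (s + 1)%R -> 0 < h s -> ou s = ov s) ->
  chain u s = chain v s.
Proof.
move=> Ru Rv; have := realizes_valid Ru s; have := realizes_valid Rv s.
have [_ ->] := Ru; have [_ ->] := Rv.
case: (ltngtP (h s) (h (s + 1)%R)) => [lt_s|lt_s|->].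
- by case: (ou s); case: (ov s) => //; rewrite leqNgt lt_s.
- by case: (ou s); case: (ov s) => //; rewrite [X in X && _]leqNgt lt_s.
- by case: (h _) => // k _ _ ->.
Qed.

Lemma walk_of_heap_inj u v : alternating u -> alternating v ->
  walk_of_heap (heap u) = walk_of_heap (heap v) -> comm_equiv m u v.
Proof.
move=> Au Av W.
have Cuv s : count_mem s v = count_mem s u.
  rewrite (Zn_natr s) -!(label_count_heap (coxeter_graph m)).
  have := congr1 (fun P : prewalk n => (wpt P (val s)).2) W.
  by rewrite !wpt_heap // ltnW // ltn_Zn.
have [ou Ru] : exists o, realizes u (fun s => count_mem s u) o.
  by eexists; apply: alternating_realizes.
have [ov Rv] : exists o, realizes v (fun s => count_mem s u) o.
  eexists; split=> // s; rewrite -!Cuv; move: s.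
  by have [_] := alternating_realizes Av; apply.
have Puv s : chain u s = chain v s.
  apply: (realizes_chain_eq Ru Rv) => Es s_gt0.
  have := congr1 (fun P : prewalk n => walk_labels P (Ordinal (ltn_Zn s))) W.
  rewrite !ffunE /= (phi_label_realizes _ Ru) (phi_label_realizes _ Rv).
  by rewrite -(Zn_natr s) -Es eqxx eqn0Ngt s_gt0 /=; case: (ou s); case: (ov s).
apply: comm_equiv_projections => s t.
rewrite affA_eq2 // !negb_and !negbK => /or3P[] /eqP-> //.
  have Dss w : [seq x <- w | x \in [:: s; s]] = [seq x <- chain w s | x == s].
    rewrite -filter_predI; apply: eq_filter => x.
    by rewrite /= !inE orbb; case: eqP.
  by rewrite !Dss Puv.
have Dst w : [seq x <- w | x \in [:: s; (s - 1)%R]] = chain w (s - 1)%R.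
  by apply: eq_filter => x; rewrite /= !inE subrK orbC.
by rewrite !Dst Puv.
Qed.

Lemma walk_of_heap_Ostar u : alternating u -> Ostar n (walk_of_heap (heap u)).
Proof.
move=> Au; have Ru := alternating_realizes Au; have Vu := realizes_valid Ru.
split.
- split=> [|i]; rewrite !wpt_heap ?label_count_heap //; last exact: ltnW.
  split=> //=; rewrite ffunE (phi_label_realizes _ Ru) -natr1.
  have := Vu i%:R%R.
  set a := count_mem _ u; set b := count_mem _ u.
  case: (ltngtP a b) => [ab|ab|<-] /=.
  + case: ifP => _ // le2.
    by constructor 1; split=> //; apply/eqP; rewrite eqn_leq le2.
  + case: ifP => _ // le2.
    by constructor 2; split=> //; apply/eqP; rewrite eqn_leq le2.
  + by move=> _; constructor 3; case: ifP.
- by rewrite !wpt_heap // Zn_natn.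
move=> i l; rewrite ffunE wpt_heap ?label_count_heap; last exact: ltnW.
rewrite (phi_label_realizes _ Ru) => + /= E0; rewrite E0 eqxx /=.
by case: ifP => // _ [].
Qed.

(** The first letter [x] of the word starts both chains through [x], so that
    the step before [x] is not labelled [R] and the step after [x] is not
    labelled [L]. *)
Lemma walk_of_heap_notin_Econst u :
  alternating u -> ~ Econst n (walk_of_heap (heap u)).
Proof.
move=> Au [_ [h [l [h_gt0 Eh El]]]]; have Ru := alternating_realizes Au.
have Cu s : count_mem s u = h.
  rewrite (Zn_natr s) -(label_count_heap (coxeter_graph m)).
  by rewrite -(Eh (val s)) ?wpt_heap // ltnW // ltn_Zn.
have lE s :
    Some l = if head s (chain u s) == (s + 1)%R then Some L else Some R.
  rewrite -(El (Ordinal (ltn_Zn s))) ffunE (phi_label_realizes _ Ru) /=.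
  by rewrite -(Zn_natr s) !Cu eqxx /= eqn0Ngt h_gt0.
case: u Cu lE {Au Ru Eh El} => [/(_ 0%R) /= E|x u _ lE].
  by rewrite -E in h_gt0.
have := lE (x - 1)%R; rewrite subrK (lE x) /= !inE !eqxx /= orbT /= eqxx.
by rewrite eq_sym (negbTE (Zn_add1_neq _ _)).
Qed.

Lemma sum_count u : \sum_(s : Z) count_mem s u = size u.
Proof.
elim: u => [|x u IHu] /=; first by rewrite big1.
rewrite big_split /= IHu (bigD1 x) //= eqxx big1 ?addn0 // => s.
by rewrite eq_sym => /negbTE->.
Qed.

Lemma ht'_heap u : ht' (walk_of_heap (heap u)) = size u.
Proof.
rewrite /ht' -sum_count (eq_bigr (fun i : 'I_n => count_mem i%:R%R u)).
  rewrite -(big_mkord xpredT (fun i => count_mem i%:R%R u)).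
  rewrite -{1}(Zp_cast (ltnW n_ge3)) big_mkord.
  by apply: eq_bigr => s _; rewrite -Zn_natr.
by move=> i _; rewrite wpt_heap ?label_count_heap // ltnW.
Qed.

(** * The alternating word of a walk *)

Definition isL (l : option step_label) := if l is Some L then true else false.

Lemma Zn_shift s t : exists k, t = (s + k%:R)%R.
Proof. by exists (val (t - s)%R); rewrite -Zn_natr addrC subrK. Qed.

(** A possible first letter of the sought word. From a letter of positive
    height, move to the right as long as the chains start with their right-hand
    letter, or else to the left as long as they start with their left-hand
    letter: the height does not decrease on the way, and the move stops because
    the orientation is not constant. *)
Lemma exists_source h o s : valid_config h o -> 0 < h s ->
  (exists t, o t) -> (exists t, ~~ o t) ->
  exists t, [/\ 0 < h t, o (t - 1)%R & ~~ o t].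
Proof.
move=> Vho hs [t1 ot1] [t0 ot0]; case: (boolP (o s)) => os.
  have ex_k : exists k, ~~ o (s + k%:R)%R.
    by have [k Ek] := Zn_shift s t0; exists k; rewrite -Ek.
  case: (ex_minnP ex_k) => -[|k] ok min_k; first by rewrite addr0 os in ok.
  have up l : l <= k -> o (s + l%:R)%R.
    by apply: contraTT => /min_k; rewrite -ltnNge.
  exists (s + k.+1%:R)%R; split=> //; last by rewrite -natr1 addrA addrK up.
  have: k < k.+1 by []; elim: {-2}k => [|l IHl] lk; rewrite -natr1 addrA.
    by have := Vho s; rewrite addr0 os => /andP[+ _]; apply: leq_trans.
  have := Vho (s + l.+1%:R)%R; rewrite up // => /andP[+ _]; apply: leq_trans.
  exact/IHl/ltnW.
have ex_k : exists k, o (s - k%:R)%R.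
  by have [k Ek] := Zn_shift t1 s; exists k; rewrite Ek addrK.
case: (ex_minnP ex_k) => -[|k] ok min_k.
  by rewrite subr0 (negbTE os) in ok.
have down l : l <= k -> ~~ o (s - l%:R)%R.
  by apply: contraTN => /min_k; rewrite -ltnNge.
exists (s - k%:R)%R; split; last exact: down.
  have: k < k.+1 by []; elim: {-2}k => [|l IHl] lk; first by rewrite subr0.
  have := Vho (s - l.+1%:R)%R; rewrite (negbTE (down _ _)) // => /andP[+ _].
  by rewrite -natr1 opprD addrA subrK; apply: leq_trans; apply/IHl/ltnW.
by move: ok; rewrite -natr1 opprD addrA.
Qed.

(** Removing a first letter [t] from a word lowers [h t] and makes the other
    letter start both chains through [t]. The new orientation takes both
    values, so the induction on the sum of the heights goes on. *)
Lemma exists_realizing h o : valid_config h o ->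
  (forall s, h s = 0) \/ (exists s, o s) /\ (exists s, ~~ o s) ->
  exists u, realizes u h o.
Proof.
have [k] := ubnP (\sum_(s : Z) h s); elim: k h o => // k IHk h o lt_k Vho Hho.
case: (pselect (exists s, 0 < h s)) => [[s0 hs0]|h0]; last first.
  have {}h0 s : h s = 0.
    by apply/eqP; rewrite eqn0Ngt; apply/negP => hs; case: h0; exists s.
  by exists [::]; split=> s; rewrite !h0.
case: Hho => [h0|[o1 o0]]; first by rewrite h0 in hs0.
have [t [ht ot1 ot]] := exists_source Vho hs0 o1 o0.
have nt1 : (t - 1)%R != t.
  by rewrite -[X in _ != X](subrK 1%R) eq_sym Zn_add1_neq.
have nt2 : (t + 1)%R != t by rewrite Zn_add1_neq.
have tE s : (s + 1 == t)%R = (s == t - 1)%R.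
  by rewrite [RHS]eq_sym subr_eq eq_sym.
pose h' s := if s == t then (h t).-1 else h s.
pose o' s := if s == t then true else if s == (t - 1)%R then false else o s.
have [|||u [Cu Pu]] := IHk h' o' _ _ (or_intror _).
- rewrite -ltnS; apply: leq_trans lt_k.
  rewrite ltnS [X in _ < X](bigD1 t) //= (bigD1 t) //=.
  rewrite {1}/h' eqxx -[X in _ < X + _](prednK ht) addSn ltnS leq_add2l.
  by apply: leq_sum => s /negbTE st; rewrite /h' st.
- move=> s; have := Vho s; rewrite /o' /h'; case: (eqVneq s t) => [->|st].
    rewrite (negbTE nt2) (negbTE ot).
    by case: (h t) ht => //= a _ /andP[le1 le2]; rewrite le1 -ltnS le2.
  rewrite tE; case: (eqVneq s (t - 1)%R) => [->|//]; rewrite subrK ot1.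
  by case: (h t) ht => //= a _ /andP[le1 le2]; rewrite le1 -ltnS le2.
- by split; [exists t | exists (t - 1)%R]; rewrite /o' ?(negbTE nt1) eqxx.
exists (t :: u); split=> s /=.
  by rewrite Cu /h' eq_sym; case: eqP => [->|_]; rewrite ?add1n ?prednK.
rewrite !inE Pu /o' /h' [t == s]eq_sym; case: (eqVneq s t) => [->|st].
  by rewrite (negbTE nt2) (negbTE ot) -[in RHS](prednK ht).
rewrite [(t == s + 1)%R]eq_sym tE; case: (eqVneq s (t - 1)%R) => [->|//].
by rewrite subrK ot1 -[in RHS](prednK ht) addnS.
Qed.

(** If the orientation read on the walk were constant, the heights would be
    monotone around the cycle, hence constant; then the walk has height 0 or
    belongs to E. *)
Lemma Ostar_walk_of_heap (P : prewalk n) : (Ostar n `\` Econst n)%classic P ->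
  exists2 u, alternating u & walk_of_heap (heap u) = P.
Proof.
move=> [[[P0 step_P] closed_P zero_P] notE].
pose lab k := if insub k is Some i then walk_labels P i else None.
pose h (s : Z) := (wpt P (val s)).2.
pose o (s : Z) :=
  (h s < h (s + 1)%R) || (h s == h (s + 1)%R) && isL (lab (val s)).
have valk k : k < n -> val (k%:R%R : Z) = k.
  by move=> kn; rewrite /= val_Zp_nat ?modn_small // ltnW.
have hE k : k <= n -> h k%:R%R = (wpt P k).2.
  rewrite leq_eqVlt => /orP[/eqP->|kn]; first by rewrite Zn_natn /h /= closed_P.
  by rewrite /h valk.
have labE (i : 'I_n) : lab (val (i%:R%R : Z)) = walk_labels P i.
  by rewrite /lab valk // valK.
have step (i : 'I_n) : let s : Z := i%:R%R in
    [/\ if o s then (h s <= h (s + 1)%R <= (h s).+1)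
        else (h (s + 1)%R <= h s <= (h (s + 1)%R).+1)
      & walk_labels P i = if h s != h (s + 1)%R then None else
                          if (h s == 0) || o s then Some L else Some R].
  rewrite /= /o labE natr1 !hE //; last exact: ltnW.
  have [_] := step_P i; case=> -[-> Hl].
  - by rewrite Hl ltnSn leqnSn (ltn_eqF (ltnSn _)).
  - by rewrite Hl (leq_gtF (leqnSn _)) (gtn_eqF (ltnSn _)) /= leqnSn ltnSn.
  rewrite ltnn eqxx /=; split; first by case: isL; rewrite leqnn leqnSn.
  have := zero_P i; case: (walk_labels P i) Hl => [[]|] // _;
    rewrite ?orbT //= orbF.
  by case: eqP => // E0 /(_ R erefl E0).
have Vho : valid_config h o.
  by move=> s; have [] := step (Ordinal (ltn_Zn s)); rewrite /= -Zn_natr.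
have [u Ru] : exists u, realizes u h o.
  apply: exists_realizing => //.
  case: (pselect (forall s, h s = 0)) => [|h_neq0]; [by left|right].
  suff const_o b : ~ (forall s, o s = b).
    split; apply: contrapT => /forallNP No.
      by apply: (const_o false) => s; apply/negbTE/negP/No.
    by apply: (const_o true) => s; apply/negPn/negP/No.
  move=> ob.
  (* Going once around the cycle, monotone heights are constant. *)
  have mono s k : if b then h s <= h (s + k%:R)%R else h (s + k%:R)%R <= h s.
    elim: k => [|k]; first by rewrite addr0 leqnn if_same.
    rewrite -natr1 addrA; have := Vho (s + k%:R)%R; rewrite ob.
    by case: b {ob} => /andP[le1 _] le2;
      [apply: leq_trans le2 le1 | apply: leq_trans le1 le2].
  have h_const s : h s = h 0%R.
    have [k E1] := Zn_shift s 0%R; have [l E2] := Zn_shift 0%R s.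
    have := mono s k; have := mono 0%R l; rewrite -E1 -E2.
    by case: b {ob mono} => le1 le2; apply/eqP; rewrite eqn_leq le1 le2.
  have h0 : h 0%R != 0 by apply/eqP => h0; apply: h_neq0 => s; rewrite h_const.
  apply: notE; split; first by split.
  exists (h 0%R), (if b then L else R); split; first by rewrite lt0n.
    by move=> i i_n; rewrite -hE // h_const.
  move=> i; have [_ ->] := step i.
  by rewrite !h_const eqxx (negbTE h0) ob; case: b {ob mono}.
have fst_P k : k <= n -> (wpt P k).1 = k.
  elim: k => [//|k IHk] kn; have [-> _] := step_P (Ordinal kn).
  by rewrite IHk // ltnW.
exists u; first exact: realizes_alternating Ru.
transitivity (Prewalk (walk_points P) (walk_labels P)); last by case: (P).
congr Prewalk; apply/ffunP => i; rewrite ffunE; last first.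
  by rewrite (phi_label_realizes _ Ru); have [_ /= ->] := step i.
have i_n : i <= n by rewrite -ltnS.
have -> : walk_points P i = wpt P i by rewrite /wpt inord_val.
rewrite label_count_heap; have [-> _] := Ru.
by rewrite [RHS]surjective_pairing fst_P // hE.
Qed.

End Walks.

Theorem theorem2p2 (n : nat) (n_ge3 : (3 <= n)%N) :
  [/\ (forall (w : coxeter_group (affA n)) (u : seq 'Z_n),
         fully_commutative (affA n) w -> reduced_expression_of w u ->
         walk_of_heap (Heap (coxeter_graph (affA n)) u) = phi' w),
      set_bij (fully_commutative (affA n)) (Ostar n `\` Econst n)%classic
        (@phi' n)
    & (forall w : coxeter_group (affA n),
         fully_commutative (affA n) w -> cox_length w = ht' (phi' w))].
Proof.
have alt w u : fully_commutative (affA n) w -> reduced_expression_of w u ->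
    alternating u.
  by move=> FC /(fully_commutative_braid_free FC)/(braid_free_alternating n_ge3).
have redP (w : coxeter_group (affA n)) : reduced_expression_of w (reduced_word w).
  exact: svalP.
have walkE w u : fully_commutative (affA n) w -> reduced_expression_of w u ->
    walk_of_heap (Heap (coxeter_graph (affA n)) u) = phi' w.
  move=> FC Ru; have Au := alternating_realizes n_ge3 (alt _ _ FC Ru).
  apply: (walk_of_heap_realizes n_ge3 Au).
  have C := FC _ _ Ru (redP w); exact: (realizes_comm_equiv n_ge3 C Au).
split=> [//||w FC]; last by rewrite /phi' ht'_heap //; have [_ ->] := redP w.
split.
- move=> w FC; have Aw := alt _ _ FC (redP w).
  by split; [apply: walk_of_heap_Ostar | apply: walk_of_heap_notin_Econst].
- move=> w w'; rewrite !inE => FC FC' E.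
  have Aw := alt _ _ FC (redP w); have Aw' := alt _ _ FC' (redP w').
  have /comm_equiv_class := walk_of_heap_inj n_ge3 Aw Aw' E; rewrite -!word_prodE.
  by have [-> _] := redP w; have [-> _] := redP w'.
- move=> P /(Ostar_walk_of_heap n_ge3)[u Au <-].
  have [Ru FC] := braid_free_fully_commutative (@affA_simply_laced n)
    (affA_gen_inj n_ge3) (alternating_braid_free n_ge3 Au).
  by exists (word_class (affA n) u); last by rewrite -(walkE _ u).
Qed.
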